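(* Let $n \ge 2$ and let $x_1 < x_2 < \dots < x_n$ be real numbers (an ordered sample). For $i = 1,\dots,n$ set $$y_i = \frac{1}{n}\sum_{j=1}^n (x_i - x_j)\, I_{x_j \le x_i}.$$ Define the forward difference estimator at the sample points by $$\hat F_O(x_i) = \frac{y_{i+1}-y_i}{x_{i+1}-x_i}\quad (i=1,\dots,n-1), \qquad \hat F_O(x_n) = 1.$$ Then $$\hat F_O(x_i) = \frac{i}{n}\quad (i=1,\dots,n-1), \qquad \hat F_O(x_n)=1.$$
   Context: $I_A$ is $1$ if the condition $A$ holds and $0$ otherwise. The number $y_i$ is the empirical left mean absolute deviation function, i.e. the sample version of $v \mapsto E[(v-X)I_{X\le v}]$, evaluated at $v = x_i$. *)

(* Defs.v *)
From HB Require Import structures.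
From mathcomp Require Import all_boot all_order all_algebra.
From mathcomp Require Import reals.

Set Implicit Arguments.
Unset Strict Implicit.
Unset Printing Implicit Defensive.

Import Order.TTheory GRing.Theory Num.Theory.
Local Open Scope ring_scope.

(* A sample x_1, ..., x_n is a function x : 'I_n -> R, so the ordinal i stands
   for the 1-based index i.+1. *)

(* Empirical version of v |-> E[(v - X) I_{X <= v}]; the boolean x j <= v is
   read as the number 0 or 1. *)
Definition emp_left_mad (R : realType) (n : nat) (x : 'I_n -> R) (v : R) : R :=
  n%:R^-1 * \sum_(j < n) (v - x j) * (x j <= v)%R%:R.

Definition left_mad_at (R : realType) (n : nat) (x : 'I_n -> R) (i : 'I_n) : R :=
  emp_left_mad x (x i).

(* insub i.+1 : option 'I_n is the index following i; it is None exactly when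
   i is the last index. *)
Definition fwd_diff_cdf (R : realType) (n : nat) (x : 'I_n -> R) (i : 'I_n) : R :=
  if insub i.+1 is Some k then
    (left_mad_at x k - left_mad_at x i) / (x k - x i)
  else 1.

(* Main.v *)
(* Consecutive sample points enclose no other one, so passing from x_i to
   x_{i+1} lengthens each of the i terms (x_i - x_j)_+, j <= i, by the gap
   x_{i+1} - x_i and changes no other term (the (i+1)-st one is zero at both
   points). *)

Require Import Defs.
From HB Require Import structures.
From mathcomp Require Import all_boot all_order all_algebra.
From mathcomp Require Import reals.

Set Implicit Arguments.
Unset Strict Implicit.
Unset Printing Implicit Defensive.

Import Order.TTheory GRing.Theory Num.Theory.
Local Open Scope ring_scope.

(** Counts the terms that grow by the gap; ordinals start at 0, whence [i.+1]. *)
Lemma sum_ord_leq (R : pzSemiRingType) (n : nat) (i : 'I_n) :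
  \sum_(j < n) (j <= i)%N%:R = i.+1%:R :> R.
Proof.
rewrite -natr_sum; congr (_%:R).
rewrite -[RHS]card_ord -sum1_card (big_ord_widen n (fun=> 1%N)) //.
rewrite [RHS]big_mkcond.
by apply: eq_bigr => j _; rewrite ltnS; case: (j <= i)%N.
Qed.

(** Turns the indicators at sample points into comparisons of indices. *)
Lemma le_ordered_sample (d : Order.disp_t) (T : porderType d) (n : nat)
    (x : 'I_n -> T) (hx : forall i j : 'I_n, (i < j)%N -> (x i < x j)%O)
    (i j : 'I_n) :
  (x i <= x j)%O = (i <= j)%N.
Proof.
case: (ltngtP i j) => [/hx/ltW->//|/hx xji|/val_inj->]; last exact: lexx.
by rewrite lt_geF.
Qed.

Lemma left_mad_atB (R : realType) (n : nat) (x : 'I_n -> R)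
    (hx : forall i j : 'I_n, (i < j)%N -> x i < x j)
    (i k : 'I_n) (hk : k = i.+1 :> nat) :
  left_mad_at x k - left_mad_at x i = i.+1%:R / n%:R * (x k - x i).
Proof.
rewrite /left_mad_at /emp_left_mad -mulrBr mulrAC mulrC; congr (_ * _).
(* Expanding [i.+1] as a sum of indicators reduces the claim to an equality of summands. *)
rewrite -sum_ord_leq mulr_suml -sumrB; apply: eq_bigr => j _.
rewrite !(le_ordered_sample hx) hk [(j <= i.+1)%N]leq_eqVlt ltnS.
(* Only at [j = i.+1] do the two indicators differ, and there the factor [x k - x j] vanishes. *)
have [ji1|_] := eqVneq (j : nat) i.+1.
  have -> : j = k by apply: val_inj; rewrite /= ji1 hk.
  by rewrite hk ltnn subrr !(mul0r, mulr0) subrr.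
case: (j <= i)%N; last by rewrite !(mulr0, mul0r) subrr.
by rewrite /= !mulr1 mul1r opprB addrA subrK.
Qed.

Theorem theorem3 (R : realType) (n : nat) (hn : (2 <= n)%N) (x : 'I_n -> R)
    (hx : forall i j : 'I_n, (i < j)%N -> x i < x j) :
  (forall i : 'I_n, (i.+1 < n)%N -> fwd_diff_cdf x i = i.+1%:R / n%:R) /\
  (forall i : 'I_n, i.+1 = n -> fwd_diff_cdf x i = 1).
Proof.
split=> i hi; rewrite /fwd_diff_cdf; last by rewrite insubF // hi ltnn.
(* The gap cancels, being nonzero by strict monotonicity. *)
rewrite insubT (left_mad_atB hx) // mulfK // subr_eq0.
by rewrite gt_eqF // hx /=.
Qed.
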